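(* Let $\mathscr{B}\subset\mathbb{N}\setminus\{1\}$ be primitive and infinite, let $\eta=\mathbf{1}_{\mathcal{F}_{\mathscr{B}}}$, and assume that $(X_\eta,S)$ is minimal. Then $X_\eta\subsetneq\widetilde{X}_\eta\subsetneq X_{\mathscr{B}}$.
   Context: $\mathbb{N}=\{1,2,\ldots\}$. $\mathscr{B}$ is primitive if no element of $\mathscr{B}$ divides a different element of $\mathscr{B}$. $\mathcal{F}_{\mathscr{B}}=\mathbb{Z}\setminus\bigcup_{b\in\mathscr{B}}b\mathbb{Z}$. $S$ is the left shift on $\{0,1\}^{\mathbb{Z}}$ and $X_\eta:=\overline{\{S^j\eta:j\in\mathbb{Z}\}}$. A system is minimal if every orbit is dense. A subshift $X\subset\{0,1\}^{\mathbb{Z}}$ is hereditary if $x\in X$ and $y\le x$ coordinatewise imply $y\in X$; $\widetilde{X}_\eta$ is the smallest hereditary subshift containing $X_\eta$. $X_{\mathscr{B}}$ is the set of all $x\in\{0,1\}^{\mathbb{Z}}$ whose support $\{i:x(i)=1\}$ misses at least one residue class modulo $b$, for every $b\in\mathscr{B}$. *)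

(* Defs.v *)
From mathcomp Require Import all_boot all_order all_algebra.
From mathcomp Require Import all_classical all_reals all_analysis.

Set Implicit Arguments.
Unset Strict Implicit.
Unset Printing Implicit Defensive.

Import Order.TTheory GRing.Theory.

Local Open Scope classical_set_scope.
Local Open Scope ring_scope.

(* {0,1}^Z with the product topology, bool being discrete. *)
Definition config : topologicalType := {ptws int -> bool}.

(* The iterate S^j, for j : int, of the left shift S = [shift 1]; see
   [shift0], [shiftD] and [shift_iter]. *)
Definition shift (j : int) (x : config) : config := fun n => x (n + j).

Lemma shift0 (x : config) : shift 0 x = x.
Proof. by apply/funext => n; rewrite /shift addr0. Qed.

Lemma shiftD (i j : int) (x : config) : shift (i + j) x = shift i (shift j x).
Proof. by apply/funext => n; rewrite /shift addrA. Qed.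

Lemma shift_iter (k : nat) (x : config) : shift k%:Z x = iter k (shift 1) x.
Proof. by elim: k => [|k IH]; rewrite ?shift0// intS shiftD IH iterS. Qed.

Definition orbit (x : config) : set config := range (shift ^~ x).

Definition subshift (X : set config) : Prop :=
  closed X /\ shift 1 @` X = X.

Definition minimal (X : set config) : Prop :=
  forall x, X x -> X `<=` closure (orbit x).

Definition hereditary (X : set config) : Prop :=
  forall x y : config, X x -> (forall i : int, (y i <= x i)%O) -> X y.

Definition primitive (B : set nat) : Prop :=
  forall b b' : nat, B b -> B b' -> b != b' -> ~~ (b %| b')%N.

Definition free_integers (B : set nat) : set int :=
  ~` \bigcup_(b in B) [set n : int | (b%:Z %| n)%Z].

Definition eta (B : set nat) : config := fun n => n \in free_integers B.

Definition X_eta (B : set nat) : set config := closure (orbit (eta B)).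

Definition tildeX_eta (B : set nat) : set config :=
  smallest [set X | subshift X /\ hereditary X] (X_eta B).

(* The intersection defining [tildeX_eta B] is itself a hereditary subshift. *)
Lemma tildeX_eta_hereditary_subshift (B : set nat) :
  subshift (tildeX_eta B) /\ hereditary (tildeX_eta B).
Proof.
split; last by move=> x y hx yx X hX; apply: (hX.1.2 x y _ yx); exact: hx.
split; first by apply: closed_bigI => X [[[]]].
apply/seteqP; split=> [_ [x hx <-] X hX|x hx].
  by rewrite -hX.1.1.2; exists x => //; exact: hx.
exists (shift (-1) x); last by rewrite -shiftD subrr shift0.
move=> X hX; have := hx X hX; rewrite -{1}hX.1.1.2 => -[y Xy <-].
by rewrite -shiftD addNr shift0.
Qed.

Definition X_admissible (B : set nat) : set config :=
  [set x | forall b, B b ->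
     exists r : int, forall i : int, x i -> (i != r %[mod b%:Z])%Z].

(* Main.v *)
(* Write F for the set of B-free integers.  Minimality gives uniform recurrence
   of eta, and since any finite set of integers can be moved by a translation
   onto positions whose B-freeness is decided by a residue class, every n in F
   is congruent, modulo any prescribed m, to some n' with n' + M Z in F for
   some M > 0.  Such a class remains in F after multiplication by units modulo
   M, which replaces Dirichlet's theorem: for b in B, F meets every nonzero
   class modulo b.  It also forbids pairwise coprime infinite B, so two elements
   b <> c of B have a common factor.  The separating point is the indicator of
   the integers that avoid 0 modulo every element of B other than c, and avoid 1
   instead of 0 modulo c: a translate of it avoiding the multiples of b and of c
   would have to be by some n divisible by b and congruent to -1 modulo c,
   contradicting the common factor. *)

Require Import Defs.
From mathcomp Require Import all_boot all_order all_algebra.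
From mathcomp Require Import all_classical all_reals all_analysis.
From mathcomp Require Import zify ring.
From HB Require Import structures.

Set Implicit Arguments.
Unset Strict Implicit.
Unset Printing Implicit Defensive.

Import Order.TTheory GRing.Theory Num.Theory.

Local Open Scope ring_scope.
Local Open Scope classical_set_scope.

(** * Free integers and finite windows of configurations *)

Lemma free_integersP (B : set nat) (n : int) :
  free_integers B n <-> forall b, B b -> ~~ (b%:Z %| n)%Z.
Proof.
split=> [Fn b Bb|Fn [b Bb] /=]; last by rewrite (negbTE (Fn b Bb)).
by apply/negP => bn; apply: Fn; exists b.
Qed.

Lemma not_free_integersP (B : set nat) (n : int) :
  ~ free_integers B n <-> exists2 b, B b & (b%:Z %| n)%Z.
Proof. by split=> [/contrapT|? /(_ _)]; [|exact]. Qed.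

Lemma nbhs_window (x : config) (s : seq int) :
  nbhs x [set y : config | {in s, forall i, y i = x i}].
Proof.
elim: s => [|a s IH]; first exact: filterS filterT.
have xa : nbhs x [set y : config | y a = x a].
  have : nbhs (x a) [set x a] by exact: discrete_set1.
  exact: (@proj_continuous _ (fun=> bool) a x).
apply: filterS2 IH xa => y ys ya i /=.
by rewrite inE => /predU1P[->//|/ys].
Qed.

Lemma closure_window (A : set config) (x : config) (s : seq int) :
  closure A x -> exists2 y, A y & {in s, forall i, y i = x i}.
Proof. by move=> /(_ _ (nbhs_window x s))[y [Ay ys]]; exists y. Qed.

Lemma compact_config : compact [set: config].
Proof.
have := @tychonoff int (fun=> bool) (fun=> setT) (fun=> bool_compact).
by congr (compact _); apply/seteqP; split.
Qed.

(** By minimality the open sets [U j] cover the compact orbit closure; a finite subcover supplies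
    [J]. *)
Lemma uniformly_recurrent (x : config) (s : seq int) :
    minimal (closure (Defs.orbit x)) ->
  exists J : seq int, forall c, exists2 j, j \in J &
    {in s, forall i, x (c + (j + i)) = x i}.
Proof.
move=> xmin; pose U (j : int) := [set y : config | {in s, forall i, y (j + i) = x i}].
have : compact (closure (Defs.orbit x)).
  exact: subclosed_compact (@closed_closure _ _) compact_config _.
(* [compact_cover] is only stated for pointed spaces. *)
pose T : ptopologicalType :=
  HB.pack {ptws int -> bool} (isPointed.Build {ptws int -> bool} (fun=> true)).
rewrite (@compact_cover T) => /(_ int setT U)[].
- move=> j _; rewrite openE => y Uy.
  apply: filterS (nbhs_window y [seq j + i | i <- s]) => z zy i si.
  by rewrite zy ?Uy// map_f.
- move=> y Xy.
  have /closure_window-/(_ s)[_ [j _ <-] ys] : closure (Defs.orbit y) x.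
    by apply: xmin Xy _ _; apply: subset_closure; exists 0 => //; exact: Defs.shift0.
  by exists j => // i si; rewrite -ys// /Defs.shift addrC.
move=> J _ XJ; exists (finmap.enum_fset J) => c.
have /XJ[j Jj Uj] : closure (Defs.orbit x) (Defs.shift c x).
  by apply: subset_closure; exists c.
by exists j => // i /Uj <-; rewrite /Defs.shift addrC.
Qed.

Lemma eta_true (B : set nat) (n : int) : Defs.eta B n <-> free_integers B n.
Proof. by split=> [/set_mem|/mem_set]. Qed.

(** * Residue classes consisting of free integers *)

Definition free_class (B : set nat) (n M : int) : Prop :=
  forall k : int, free_integers B (n + k * M).

(** If the class of [N + a] contains a multiple of some [b] in [B], translating [N] onto it and
    replacing [M] by [M * b] leaves only multiples of [b]; classes decided earlier merely shrink. *)
Lemma decided_class (B : set nat) (s : seq int) :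
    (forall b, B b -> (0 < b)%N) ->
  exists N M : int, 0 < M /\
    {in s, forall i, free_class B (N + i) M \/
                     forall k, ~ free_integers B (N + i + k * M)}.
Proof.
move=> B_gt0; elim: s => [|a s [N [M [M0 IH]]]]; first by exists 0, 1.
have [Fa|/existsNP[k0 /not_free_integersP[b Bb bk0]]] :=
  pselect (free_class B (N + a) M).
  exists N, M; split=> // i; rewrite inE => /predU1P[->|/IH//]; by left.
have b0 := B_gt0 _ Bb.
exists (N + k0 * M), (M * b%:Z); split; first by rewrite mulr_gt0.
have NE i k : N + k0 * M + i + k * (M * b%:Z) = N + i + (k0 + k * b%:Z) * M by ring.
move=> i; rewrite inE => /predU1P[->|/IH[Fi|Fi]].
- right=> k; apply/not_free_integersP; exists b => //.
  have -> : N + k0 * M + a + k * (M * b%:Z) = N + a + k0 * M + k * M * b%:Z by ring.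
  by rewrite rpredD// dvdz_mull.
- by left=> k; rewrite NE; exact: Fi.
- by right=> k; rewrite NE; exact: Fi.
Qed.

(** Recurrence copies the pattern of [eta B] on [s] to decided positions, where the copy of a free
    integer rules out the non-free alternative. *)
Lemma free_window (B : set nat) (s : seq int) :
    (forall b, B b -> (0 < b)%N) -> minimal (X_eta B) ->
  exists t : int, {in s, forall i, free_integers B i ->
    exists2 M : int, 0 < M & free_class B (t + i) M}.
Proof.
move=> B_gt0 /(uniformly_recurrent s)[J HJ].
have [N [M [M0 HN]]] := decided_class [seq j + i | j <- J, i <- s] B_gt0.
have [j Jj rec] := HJ N; exists (N + j) => i si Fi; exists M => //.
have /eta_true : Defs.eta B (N + (j + i)) by rewrite rec//; exact/eta_true.
rewrite -addrA; case: (HN (j + i) _) => [|//|/(_ 0)]; first exact: allpairs_f.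
by rewrite mul0r addr0.
Qed.

(* The translation [t] of [free_window] maps the residues modulo [m] of the free
   integers to themselves, hence permutes them, [m - 1] steps undoing one step;
   so the residue of [n] is reached from that of a free integer of the window. *)
Lemma free_class_approx (B : set nat) (n m : int) :
    (forall b, B b -> (0 < b)%N) -> minimal (X_eta B) ->
    free_integers B n -> 0 < m ->
  exists n' M : int, [/\ (m %| n' - n)%Z, 0 < M & free_class B n' M].
Proof.
move=> B_gt0 Bmin Fn m0.
pose C (z f : int) := free_integers B f /\ (m %| f - z)%Z.
(* One free integer for each class modulo [m] that meets F; the default 0 stands in for the other
   classes. *)
pose s : seq int := [seq xget 0 (C i%:Z) | i <- iota 0 `|m|%N].
have [t Ht] := free_window s B_gt0 Bmin.
have repr (z f : int) : C z f -> exists2 f', f' \in s & C z f'.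
  move=> [Ff fz]; have r0 := modz_ge0 z (lt0r_neq0 m0).
  have [r rE] : exists r : nat, (z %% m)%Z = r%:Z by exists `|(z %% m)%Z|%N; lia.
  have zr : (m %| z - r%:Z)%Z by rewrite -rE {1}(divz_eq z m) addrK dvdz_mull.
  have Cr : C r%:Z (xget 0 (C r%:Z)).
    apply: (xgetPex 0); exists f; split => //.
    by rewrite (_ : f - r%:Z = f - z + (z - r%:Z)) ?(rpredD fz zr)//; ring.
  have sr : xget 0 (C r%:Z) \in s.
    by apply/map_f; rewrite mem_iota/=; have := ltz_pmod z m0; lia.
  move: (xget 0 (C r%:Z)) Cr sr => f' [Ff' f'r] sf'; exists f' => //; split=> //.
  by rewrite (_ : f' - z = f' - r%:Z - (z - r%:Z)) ?(rpredB f'r zr)//; ring.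
have translate (k : nat) : exists f, C (n + t * k%:Z) f.
  elim: k => [|k [f /repr[f' sf' [Ff' f'z]]]].
    by exists n; split; rewrite // mulr0 addr0 subrr.
  have [M _ /(_ 0)] := Ht f' sf' Ff'; rewrite mul0r addr0 => Ftf'.
  exists (t + f'); split => //.
  by rewrite (_ : _ - _ = f' - (n + t * k%:Z))// intS; ring.
have [f /repr[f' sf' [Ff' f'z]]] := translate `|m - 1|%N.
have [M M0 FM] := Ht f' sf' Ff'; exists (t + f'), M; split => //.
rewrite (_ : _ - n = f' - (n + t * `|m - 1|%N%:Z) + t * m).
  by rewrite rpredD// dvdz_mull.
by rewrite (_ : `|m - 1|%N%:Z = m - 1); [ring|lia].
Qed.

(** If [b] divided [u * n], multiplying by an inverse of [u] modulo [M] would give a multiple of [b]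
    in the class of [n]. *)
Lemma free_class_unit_mul (B : set nat) (n M u : int) :
  free_class B n M -> coprimez u M -> free_integers B (u * n).
Proof.
move=> Fn /coprimezP[[v w]/= vw]; apply/free_integersP => b Bb.
apply/negP => bun; have /free_integersP/(_ b Bb)/negP := Fn (- (w * n)); apply.
rewrite (_ : _ + _ = v * (u * n)) ?(dvdz_mull v bun)//.
by rewrite -{1}(mul1r n) -vw; ring.
Qed.

(** * Lifting and varying units *)

(** With [P] the product of the primes of [N] not dividing [a], each prime of [N] divides exactly
    one of [a] and [P * m]. *)
Lemma coprimez_lift (a m N : int) :
  coprimez a m -> N != 0 -> exists k : int, coprimez (a + k * m) N.
Proof.
move=> am N0.
pose P := (\prod_(p <- primes `|N|%N | ~~ (p %| `|a|)%N) p)%N.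
exists P%:Z; rewrite coprimezE /coprime; set g := gcdn _ _.
apply/contraT => g1.
have g0 : (0 < g)%N by rewrite gcdn_gt0 !absz_gt0 N0 orbT.
have [p p_pr] : exists2 p, prime p & (p %| g)%N.
  by exists (pdiv g); rewrite ?pdiv_dvd// pdiv_prime//; lia.
rewrite dvdn_gcd => /andP[pa pN].
have pPm : (p%:Z %| a + P%:Z * m)%Z by rewrite dvdzE.
have [p_a|p_na] := boolP (p %| `|a|)%N.
  have pP : (p %| P * `|m|)%N.
    have : (p%:Z %| P%:Z * m)%Z by rewrite -(addKr a (P%:Z * m)) rpredD// rpredN dvdzE.
    by rewrite dvdzE abszM.
  move: pP; rewrite Euclid_dvdM// => /orP[|p_m].
    rewrite Euclid_dvd_prod// big_has_cond => /hasP[q] /=.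
    rewrite mem_primes => /and3P[q_pr _ _] /andP[q_na].
    by rewrite dvdn_prime2// => /eqP pq; rewrite -pq p_a in q_na.
  move: am; rewrite coprimezE => /coprime_dvdl-/(_ _ p_a)/coprime_dvdr-/(_ _ p_m).
  by rewrite /coprime gcdnn; case: p p_pr {pa pN pPm p_a p_m} => [|[]].
have pP : (p %| P)%N.
  rewrite /P (big_rem p)/= ?p_na ?dvdn_mulr// mem_primes p_pr absz_gt0 N0; exact: pN.
case/negP: p_na; have : (p%:Z %| a)%Z; last by rewrite dvdzE.
by rewrite -(addrK (P%:Z * m) a) rpredB// dvdz_mulr// dvdzE.
Qed.

(** After cancelling the gcd, [s] is prime to what remains of [b], so it lifts to a unit modulo
    [N]. *)
Lemma exists_unit_multiple (s b N : int) : b != 0 -> N != 0 ->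
  exists2 u : int, coprimez u N & (b %| gcdz s b * u - s)%Z.
Proof.
move=> b0 N0; set g := gcdz s b.
have g0 : g != 0 by rewrite gcdz_eq0 negb_and b0 orbT.
have [/dvdzP[s' sE] /dvdzP[b' bE]] := (dvdz_gcdl s b, dvdz_gcdr s b).
have [x [y xy]] := Bezoutz s b.
rewrite -/g in sE bE xy.
have s'b' : coprimez s' b'.
  apply/coprimezP; exists (x, y); apply: (mulIf g0).
  by rewrite mul1r /= -[RHS]xy sE bE; ring.
have [k ku] := coprimez_lift s'b' N0.
exists (s' + k * b') => //.
rewrite sE (_ : _ - _ = k * (b' * g)); last by ring.
by rewrite -bE dvdz_mull.
Qed.

(* When [c %/ gcdz b c = 2] and [b] is odd, a unit modulo [c] is determined by its
   residue modulo [b], so there is no such [v]. *)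
Lemma unit_variation (b c u : int) : 0 < b -> 0 < c ->
    2 < (c %/ gcdz b c)%Z -> coprimez u (b * c) ->
  exists v : int, [/\ coprimez v (b * c), (b %| v - u)%Z & ~~ (c %| v - u)%Z].
Proof.
move=> b0 c0; set d := gcdz b c; set e := (c %/ d)%Z => e2.
have cE : c = e * d by rewrite divzK ?dvdz_gcdr.
have [b' bE] := dvdzP (dvdz_gcdl b c).
have d0 : d != 0 by rewrite gcdz_eq0 (gt_eqF b0).
have b'e : coprimez b' e.
  have [x [y xy]] := Bezoutz b c; rewrite -/d in bE xy.
  apply/coprimezP; exists (x, y); apply: (mulIf d0).
  by rewrite mul1r /= -[RHS]xy bE cE; ring.
rewrite coprimezMr => /andP[ub uc].
have ue : coprimez u e by move: uc; rewrite cE coprimezMr => /andP[].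
have cop (v : int) : coprimez v b -> coprimez v e -> coprimez v (b * c).
  move=> vb ve; rewrite coprimezMr vb cE coprimezMr ve /=.
  by move: vb; rewrite bE coprimezMr => /andP[].
have cop_shift (v w m : int) : (m %| v - w)%Z -> coprimez w m -> coprimez v m.
  move=> /dvdzP[k vw] /coprimezP[[x y]/= xy].
  apply/coprimezP; exists (x, y - x * k); rewrite /= -xy.
  by rewrite -(subrK w v) vw; ring.
have [be|nbe] := boolP (coprimez b e).
  have [[x y]/= xy] := coprimezP _ _ be.
  have ye : y * e = 1 - x * b by rewrite -xy; ring.
  (* [v] is [u] modulo [b] and [- u] modulo [e]. *)
  exists (u - 2 * u * x * b); split.
  - apply: cop; first by apply: cop_shift ub; rewrite addrC addKr rpredN dvdz_mull.
    apply: (@cop_shift _ (- u)); last by rewrite coprimeNz.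
    rewrite (_ : _ - _ = 2 * u * (y * e)); first by rewrite !dvdz_mull.
    by rewrite ye; ring.
  - by rewrite addrC addKr rpredN dvdz_mull.
  rewrite addrC addKr rpredN; apply/negP => cx.
  have : (e %| 2 * u)%Z.
    have -> : 2 * u = 2 * u * x * b + 2 * u * (y * e) by rewrite ye; ring.
    rewrite rpredD//; last by rewrite !dvdz_mull.
    by apply: dvdz_trans cx; rewrite cE dvdz_mulr.
  rewrite Gauss_dvdzl 1?coprimez_sym// dvdzE => /dvdn_leq; lia.
have [q0 q1] : gcdz b e != 0 /\ gcdz b e != 1 by split; rewrite // gcdz_eq0 (gt_eqF b0).
have [k kE] := dvdzP (dvdz_gcdr b e).
have qb := dvdz_gcdl b e.
have q_gt0 : 0 < gcdz b e by rewrite lt0r q0.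
(* Adding [b * e / gcd b e] to [u] keeps it prime to [e]: a prime divisor of [e]
   divides [e / gcd b e] or [b]. *)
have shiftE m : (m %| u + k * b - u)%Z = (m %| k * b)%Z by rewrite addrAC subrr add0r.
exists (u + k * b); rewrite !shiftE dvdz_mull//; split=> //.
- have ub' : coprimez (u + k * b) b by apply: cop_shift ub; rewrite shiftE dvdz_mull.
  apply: cop => //; rewrite kE coprimezMr; apply/andP; split.
    apply: (@cop_shift _ u); first by rewrite shiftE dvdz_mulr.
    by move: ue; rewrite {1}kE coprimezMr => /andP[].
  by have [z zE] := dvdzP qb; move: ub'; rewrite {2}zE coprimezMr => /andP[].
(* If [c] divided [k * b], then [e] would divide [k]; but [e] is [k] times a gcd exceeding 1. *)
rewrite {1}cE {1}bE mulrA dvdz_mul2r// Gauss_dvdzl; last by rewrite coprimez_sym.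
rewrite dvdzE; apply/negP => /dvdn_leq ek.
have k_gt0 : 0 < k by rewrite -(pmulr_lgt0 _ q_gt0) -kE; lia.
have : `|e|%N = (`|k| * `|gcdz b e|)%N by rewrite {1}kE abszM.
have : (1 < `|gcdz b e|)%N by lia.
move: `|gcdz b e|%N `|e|%N ek (k_gt0 : is_true (0 < k)) => q E ek k0.
have : (0 < `|k|)%N by lia.
by move: `|k|%N ek; clear; nia.
Qed.

(** * Arithmetic consequences of minimality *)

(** The gcd [g] is free: by primitivity only [b] itself could divide it, and [b] does not divide
    [s]. A free class near [g] is then multiplied by a lift of [u] to a unit modulo [M]. *)
Lemma free_integers_meet_class (B : set nat) (b : nat) (s N u : int) :
    (forall b, B b -> (0 < b)%N) -> primitive B -> minimal (X_eta B) ->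
    B b -> ~~ (b%:Z %| s)%Z -> 0 < N -> coprimez u N ->
  exists2 i, free_integers B i & (N %| i - gcdz s b * u)%Z.
Proof.
move=> B_gt0 Bprim Bmin Bb nbs N0 uN; set g := gcdz s b.
have Fg : free_integers B g.
  apply/free_integersP => b' Bb'; apply: contra nbs; rewrite dvdz_gcd => /andP[b's b'b].
  have [<-//|/(Bprim _ _ Bb' Bb)] := eqVneq b' b.
  by rewrite dvdzE in b'b; rewrite b'b.
have [n [M [ng M0 FM]]] := free_class_approx B_gt0 Bmin Fg N0.
have [k kM] := coprimez_lift uN (lt0r_neq0 M0).
exists ((u + k * N) * n); first exact: free_class_unit_mul FM kM.
rewrite (_ : _ - _ = u * (n - g) + k * n * N); last by ring.
by rewrite rpredD ?dvdz_mull.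
Qed.

(** For a free class modulo [M], two elements of the infinite [B] have the same gcd with [M]. Were
    they coprime, this gcd would be 1 and the class would contain a multiple of [b]. *)
Lemma infinite_minimal_not_coprime (B : set nat) :
    (forall b, B b -> (1 < b)%N) -> infinite_set B -> minimal (X_eta B) ->
  exists b c : nat, [/\ B b, B c, b != c & gcdz b c != 1].
Proof.
move=> B_gt1 Binf Bmin.
have B_gt0 b : B b -> (0 < b)%N by move=> /B_gt1 /ltnW.
have F1 : free_integers B 1.
  by apply/free_integersP => b /B_gt1 b1; rewrite dvdzE dvdn1; lia.
have [n [M [_ M0 FM]]] := free_class_approx B_gt0 Bmin F1 (ltr01 : (0 : int) < 1).
pose f b := gcdn b `|M|%N.
have [finj|] := pselect ({in B &, injective f}).
  case: Binf; rewrite -(eq_finite_set (inj_card_eq finj)).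
  apply: sub_finite_set (finite_II `|M|.+1) => _ [b _ <-] /=.
  by rewrite ltnS dvdn_leq ?dvdn_gcdr//; lia.
move=> /existsNP[b /existsNP[c]] /not_implyP[/set_mem Bb] /not_implyP[/set_mem Bc].
move=> /not_implyP[fbc /eqP bc]; exists b, c; split => //; apply/eqP => gbc.
have fb : f b = 1%N.
  apply/eqP; rewrite -dvdn1; have : (f b %| gcdn b c)%N.
    by rewrite dvdn_gcd dvdn_gcdl fbc dvdn_gcdl.
  by case: gbc => ->.
have /coprimezP[[x y]/= xy] : coprimez b M by rewrite coprimezE; apply/eqP.
have /free_integersP/(_ b Bb)/negP := FM (- (n * y)); apply.
rewrite (_ : _ + _ = n * (x * b)); first by rewrite !dvdz_mull.
by rewrite (_ : x * b = 1 - y * M); [|rewrite -xy]; ring.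
Qed.

(** * Bounds on the hereditary closure *)

(** The bounding set is a hereditary subshift containing [eta B]; it is closed because periodicity
    of [D] leaves finitely many translations to test. *)
Lemma tildeX_eta_avoid (B : set nat) (D : set int) (m : int) :
    0 < m -> (forall n k, D n -> D (n + k * m)) ->
    (forall n, free_integers B n -> ~ D n) ->
  tildeX_eta B `<=` [set x : config | exists n, forall i, x i -> ~ D (i + n)].
Proof.
move=> m0 Dper FD; set Y := [set _ | _].
have Yclosed : closed Y.
  move=> x Yx; apply: contrapT => /forallNP xD.
  pose i n := xget 0 [set i | x i /\ D (i + n)].
  have iP n : x (i n) /\ D (i n + n).
    have /existsNP[j /not_implyP[xj /contrapT Dj]] := xD n.
    by apply: (xgetPex 0 (P := [set i | x i /\ D (i + n)])); exists j.
  (* The window holds one obstruction for each translation from 0 to [m - 1]. *)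
  have [y [n yn] yx] := closure_window [seq i k%:Z | k <- iota 0 `|m|%N] Yx.
  have r0 := modz_ge0 n (lt0r_neq0 m0); have rm := ltz_pmod n m0.
  have [r rE] : exists r : nat, (n %% m)%Z = r%:Z by exists `|(n %% m)%Z|%N; lia.
  have [xi Di] := iP r%:Z.
  apply: (yn (i r%:Z)); first by rewrite yx//; apply/map_f; rewrite mem_iota; lia.
  rewrite (_ : _ + n = i r%:Z + r%:Z + (n %/ m)%Z * m); first exact: Dper.
  by rewrite {1}(divz_eq n m) rE; ring.
have Yshift j x : Y x -> Y (Defs.shift j x).
  move=> [n xn]; exists (n + j) => i /xn; congr (~ D _); ring.
apply: smallest_sub.
  split; last first.
    move=> x y [n xn] yx; exists n => i yi; apply: xn.
    by have := yx i; rewrite yi; case: (x i).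
  split => //; apply/seteqP; split=> [_ [x Yx <-]|x Yx]; first exact: Yshift.
  exists (Defs.shift (-1) x); first exact: Yshift.
  by rewrite -shiftD subrr Defs.shift0.
rewrite /X_eta closureE; apply: smallest_sub => // _ [j _ <-]; apply: Yshift.
by exists 0 => i /eta_true; rewrite addr0; exact: FD.
Qed.

Lemma tildeX_eta_sub_admissible (B : set nat) :
  (forall b, B b -> (0 < b)%N) -> tildeX_eta B `<=` X_admissible B.
Proof.
move=> B_gt0 x Xx b Bb.
have b0 := B_gt0 b Bb; pose D : set int := [set n | (b%:Z %| n)%Z].
have [n xn] : exists n, forall i, x i -> ~ D (i + n).
  apply: (tildeX_eta_avoid (m := b%:Z)) Xx => //.
  - by move=> n k; rewrite /D /= => bn; rewrite rpredD// dvdz_mull.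
  - by move=> n /free_integersP/(_ b Bb)/negP.
exists (- n) => i /xn /negP; apply: contra; rewrite eqz_mod_dvd opprK.
exact.
Qed.

(** The zero configuration is in the hereditary closure but, being a fixed point, its orbit cannot
    approach [eta B], which is 1 at the free integer 1. *)
Lemma tildeX_eta_not_sub_X_eta (B : set nat) :
    (forall b, B b -> (1 < b)%N) -> minimal (X_eta B) ->
  ~ tildeX_eta B `<=` X_eta B.
Proof.
move=> B_gt1 Bmin sub.
have eta_in : X_eta B (Defs.eta B).
  by apply: subset_closure; exists 0 => //; exact: Defs.shift0.
have X0 : X_eta B (fun=> false).
  apply: sub => X [[_ Xher] /(_ _ eta_in) Xeta].
  exact: Xher Xeta _.
have /closure_window-/(_ [:: 1])[_ [j _ <-] /(_ 1)] := Bmin _ X0 _ eta_in.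
rewrite mem_head /Defs.shift => /(_ isT) eta1.
have /eta_true : free_integers B 1.
  by apply/free_integersP => b /B_gt1 b1; rewrite dvdzE dvdn1; lia.
by rewrite -eta1.
Qed.

(** * The separating admissible point *)

Lemma dvdz_congr (m x y : int) : (m %| x - y)%Z -> (m %| x)%Z = (m %| y)%Z.
Proof. by move=> mxy; rewrite -[x in LHS](subrK y) (rpredDl _ mxy). Qed.

Lemma exists_admissible_not_tildeX_eta (B : set nat) (b c : nat) :
    (forall b, B b -> (1 < b)%N) -> primitive B -> minimal (X_eta B) ->
    B b -> B c -> b != c -> gcdz b c != 1 -> 2 < (c%:Z %/ gcdz b c)%Z ->
  ~ X_admissible B `<=` tildeX_eta B.
Proof.
move=> B_gt1 Bprim Bmin Bb Bc bc gbc cg sub.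
have B_gt0 a : B a -> (0 < a)%N by move=> /B_gt1 /ltnW.
pose A : set int := [set i | (forall a, B a -> a != c -> ~~ (a%:Z %| i)%Z) /\
                             ~~ (c%:Z %| i - 1)%Z].
pose x : config := fun i => `[< A i >].
have FA i : free_integers B i -> ~~ (c%:Z %| i - 1)%Z -> A i.
  by move=> /free_integersP Fi i1; split=> // a Ba _; exact: Fi.
have /sub xX : X_admissible B x.
  move=> a Ba; have [->|ac] := eqVneq a c.
    by exists 1 => i /asboolP[_]; rewrite eqz_mod_dvd.
  by exists 0 => i /asboolP[/(_ a Ba ac) ai _]; rewrite eqz_mod_dvd subr0.
have b0 : (0 : int) < b := B_gt0 _ Bb; have c0 : (0 : int) < c := B_gt0 _ Bc.
have [bN0 cN0] := (lt0r_neq0 b0, lt0r_neq0 c0).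
pose D : set int := [set n | (b%:Z %| n)%Z || (c%:Z %| n)%Z].
have [n xn] : exists n, forall i, x i -> ~ D (i + n).
  apply: (tildeX_eta_avoid (m := b%:Z * c%:Z)) xX.
  - by rewrite mulr_gt0.
  - move=> n k; have nk : n + k * (b%:Z * c%:Z) - n = k * b%:Z * c%:Z by ring.
    rewrite /D /= (@dvdz_congr b _ n) ?nk; last by rewrite mulrAC dvdz_mull.
    by rewrite (@dvdz_congr c _ n) ?nk// dvdz_mull.
  - move=> n /free_integersP Fn.
    by rewrite /D /= (negbTE (Fn _ Bb)) (negbTE (Fn _ Bc)).
have An i : A i -> ~~ (b%:Z %| i + n)%Z /\ ~~ (c%:Z %| i + n)%Z.
  by move=> /asboolT Ai; apply/andP; rewrite -negb_or; apply/negP; exact: xn.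
(* When [c] divides [n], the point [c] of [A] is moved to a multiple of [c]. *)
have [cn|ncn] := boolP (c%:Z %| n)%Z.
  suff /An[_] : A c%:Z by rewrite rpredD.
  split=> [a Ba ac|]; first by rewrite dvdzE; exact: Bprim.
  by rewrite rpredBl// dvdzE dvdn1; have := B_gt1 _ Bc; lia.
suff [i [Fi i1 bci]] : exists i, [/\ free_integers B i, ~~ (c%:Z %| i - 1)%Z &
    (b%:Z %| i + n)%Z || (c%:Z %| i + n)%Z].
  by have [/negbTE bi /negbTE ci] := An i (FA i Fi i1); rewrite bi ci in bci.
(* If [n] is not [- 1] modulo [c], some free integer is [- n] modulo [c]; otherwise
   [b] does not divide [n] and a free integer [- n] modulo [b] is used, which has
   to be kept away from the forbidden class [1] modulo [c]. *)
have [cn1|ncn1] := boolP (c%:Z %| n + 1)%Z; last first.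
  have [u uc cu] := exists_unit_multiple (- n) cN0 cN0.
  have [|i Fi ci] := free_integers_meet_class (s := - n) B_gt0 Bprim Bmin Bc _ c0 uc.
    by rewrite rpredN.
  have cin : (c%:Z %| i + n)%Z.
    rewrite (dvdz_congr (y := gcdz (- n) c * u - - n))//.
    by rewrite (_ : _ - _ = i - gcdz (- n) c * u)//; ring.
  exists i; split => //; last by rewrite cin orbT.
  rewrite (dvdz_congr (y := - (n + 1))) ?rpredN//.
  by rewrite (_ : _ - _ = i + n)//; ring.
have nbn : ~~ (b%:Z %| - n)%Z.
  rewrite rpredN; apply: contra gbc => bn.
  have : (gcdz b c %| 1%R)%Z.
    rewrite (_ : 1 = n + 1 - n); last by ring.
    by rewrite rpredB//; [apply: dvdz_trans cn1; exact: dvdz_gcdr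
                         |apply: dvdz_trans bn; exact: dvdz_gcdl].
  by rewrite dvdzE dvdn1; lia.
set g := gcdz (- n) b.
have gc : coprimez g c.
  have [k kn] := dvdzP (dvdz_gcdl (- n) b); have [l ln] := dvdzP cn1.
  apply/coprimezP; exists (k, l); rewrite /= -ln -kn; ring.
have [u ubc bu] := exists_unit_multiple (- n) bN0 (mulf_neq0 bN0 cN0).
have [v [vbc bvu ncvu]] := unit_variation b0 c0 cg ubc.
(* One of [u] and its variation [v] works: if both products with [g] were 1 modulo [c], then [c]
   would divide [v - u], as [g] is prime to [c]. *)
have [w [wbc bw cw]] : exists w, [/\ coprimez w (b%:Z * c%:Z),
    (b%:Z %| g * w + n)%Z & ~~ (c%:Z %| g * w - 1)%Z].
  rewrite -/g opprK in bu.
  have [cu|] := boolP (c%:Z %| g * u - 1)%Z; last by exists u.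
  exists v; split => //.
    rewrite (dvdz_congr (y := g * u + n))// (_ : _ - _ = g * (v - u)); last by ring.
    by rewrite dvdz_mull.
  apply: contra ncvu => cv; rewrite -(@Gauss_dvdzr _ g) 1?coprimez_sym//.
  by rewrite (_ : _ * _ = g * v - 1 - (g * u - 1)); [rewrite rpredB|ring].
have [i Fi /dvdzP[k ik]] :=
  free_integers_meet_class B_gt0 Bprim Bmin Bb nbn (mulr_gt0 b0 c0) wbc.
rewrite -/g in ik; exists i; split => //.
  rewrite (dvdz_congr (y := g * w - 1))//.
  by rewrite (_ : _ - _ = k * b%:Z * c%:Z) ?dvdz_mull//; rewrite -mulrA -ik; ring.
rewrite (dvdz_congr (y := g * w + n)) ?bw//.
rewrite (_ : _ - _ = k * c%:Z * b%:Z) ?dvdz_mull//.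
by rewrite -mulrA [c%:Z * _]mulrC -ik; ring.
Qed.

Theorem corollary1p4 (B : set nat)
    (B_gt1 : forall b : nat, B b -> (1 < b)%N)
    (B_primitive : primitive B)
    (B_infinite : infinite_set B)
    (X_eta_minimal : minimal (X_eta B)) :
  X_eta B `<` tildeX_eta B /\ tildeX_eta B `<` X_admissible B.
Proof.
have B_gt0 b : B b -> (0 < b)%N by move=> /B_gt1 /ltnW.
split; (split; last first).
- exact: tildeX_eta_not_sub_X_eta.
- exact: sub_smallest.
- have [b [c [Bb Bc bc gbc]]] :=
    infinite_minimal_not_coprime B_gt1 B_infinite X_eta_minimal.
  have [cg|cg] := ltP 2 (c%:Z %/ gcdz b c)%Z.
    exact: exists_admissible_not_tildeX_eta gbc cg.
  have [bg|bg] := ltP 2 (b%:Z %/ gcdz c b)%Z.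
    have [cb gcb] : c != b /\ gcdz c b != 1 by rewrite eq_sym gcdzC.
    exact: exists_admissible_not_tildeX_eta gcb bg.
  (* Both quotients are now at most 2; a quotient 1 would contradict primitivity, so both are 2 and
     [b = c]. *)
  exfalso; rewrite gcdzC in bg.
  have [b0 c0] := (B_gt0 b Bb, B_gt0 c Bc).
  have nbc := B_primitive _ _ Bb Bc bc.
  have ncb : ~~ (c %| b)%N by apply: B_primitive; rewrite // eq_sym.
  have bE := divzK (dvdz_gcdl b c); have cE := divzK (dvdz_gcdr b c).
  have d0 : 0 <= gcdz b c by [].
  move: (gcdz b c) (b%:Z %/ gcdz b c)%Z (c%:Z %/ gcdz b c)%Z d0 bE cE bg cg.
  move=> d p q d0 bE cE p2 q2.
  have p1 : p != 1.
    apply: contra nbc => /eqP p1.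
    by rewrite -[(_ %| _)%N]/(b%:Z %| c%:Z)%Z -bE -cE p1 mul1r dvdz_mull.
  have q1 : q != 1.
    apply: contra ncb => /eqP q1.
    by rewrite -[(_ %| _)%N]/(c%:Z %| b%:Z)%Z -bE -cE q1 mul1r dvdz_mull.
  have [pE qE] : p = 2 /\ q = 2 by split; nia.
  by move/eqP: bc; apply; lia.
- exact: tildeX_eta_sub_admissible.
Qed.
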